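(* Let $\mathcal{L}$ be the syntax category, let $f,g\colon\mathcal{L}\to[0,1]$ be $[0,1]$-copresheaves, and let $w_1,w_2\in[0,1]$. Let $\mathcal{J}$ be the discrete $[0,1]$-category with two objects $1,2$ and $\mathcal{J}(i,j)=\delta_{ij}$, let $W\colon\mathcal{J}^{\mathrm{op}}\to[0,1]$ be the functor of weights $W(1)=w_1$, $W(2)=w_2$, and let $F\colon\mathcal{J}\to\widehat{\mathcal{L}}$ be the diagram $F(1)=f$, $F(2)=g$. Then the weighted colimit $(w_1,f)\sqcup(w_2,g):=\operatorname{colim}_W F$ exists in $\widehat{\mathcal{L}}$, and it is the copresheaf $\mathcal{L}\to[0,1]$ given by $$c\mapsto\max\{w_1fc,\,w_2gc\}.$$
   Context: The unit interval $[0,1]$ is a commutative monoidal preorder under $\le$ and multiplication, with internal hom $[a,b]:=b/a$ if $b<a$ and $[a,b]:=1$ otherwise. A $[0,1]$-category $\mathcal{C}$ is a set of objects with numbers $\mathcal{C}(x,y)\in[0,1]$ such that $\mathcal{C}(x,x)=1$ and $\mathcal{C}(y,z)\mathcal{C}(x,y)\le\mathcal{C}(x,z)$ for all $x,y,z$. Its opposite $\mathcal{C}^{\mathrm{op}}$ has the same objects and $\mathcal{C}^{\mathrm{op}}(x,y)=\mathcal{C}(y,x)$ (so here $\mathcal{J}^{\mathrm{op}}=\mathcal{J}$). A $[0,1]$-functor $F\colon \mathcal{C}\to\mathcal{D}$ is a function on objects with $\mathcal{C}(x,y)\le\mathcal{D}(Fx,Fy)$. A $[0,1]$-copresheaf on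 $\mathcal{C}$ is a function $f\colon\mathcal{C}\to[0,1]$ with $\mathcal{C}(x,y)\le[fx,fy]$ for all $x,y$. The $[0,1]$-category of copresheaves $\widehat{\mathcal{C}}=[0,1]^{\mathcal{C}}$ has hom objects $\widehat{\mathcal{C}}(f,g)=\inf_{c\in\mathcal{C}}[fc,gc]$. The syntax category $\mathcal{L}$ is the $[0,1]$-category whose objects are the expressions (texts) of a language and whose hom objects are $\mathcal{L}(x,y):=\pi(y|x)\in[0,1]$, the probability that $y$ extends $x$, where $\pi(y|x)=0$ if $x$ is not a subtext of $y$; being a $[0,1]$-category means $\pi(x|x)=1$ and $\pi(z|y)\pi(y|x)\le\pi(z|x)$ for all $x,y,z$. The weighted colimit $\operatorname{colim}_W F$ is an object of $\widehat{\mathcal{L}}$ such that $\widehat{\mathcal{L}}(\operatorname{colim}_WF,Z)=[0,1]^{\mathcal{J}^{\mathrm{op}}}(W,\widehat{\mathcal{L}}(F,Z))$ for every copresheaf $Z$ on $\mathcal{L}$, where $\widehat{\mathcal{L}}(F,Z)$ is $i\mapsto\widehat{\mathcal{L}}(F(i),Z)$ and $[0,1]^{\mathcal{J}^{\mathrm{op}}}(W,V)=\min_{i\in\{1,2\}}[W(i),V(i)]$. *)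

(* Defs.v *)
From HB Require Import structures.
From mathcomp Require Import all_boot all_order all_algebra.
From mathcomp Require Import boolp classical_sets reals interval_inference.

Set Implicit Arguments.
Unset Strict Implicit.
Unset Printing Implicit Defensive.

Import Order.TTheory GRing.Theory Num.Theory.
Local Open Scope classical_set_scope.
Local Open Scope ring_scope.

Section UnitInterval.
Variable R : realType.
Implicit Types a b c : {i01 R}.

Definition ihom_num a b : R :=
  if b%:num < a%:num then b%:num / a%:num else 1.

Lemma ihom_num_ge0 a b : 0 <= ihom_num a b.
Proof. by rewrite /ihom_num; case: ifP => // _; rewrite divr_ge0. Qed.

Lemma ihom_num_le1 a b : ihom_num a b <= 1.
Proof.
rewrite /ihom_num; case: ifP => // ba; have a0 : 0 < a%:num by exact: le_lt_trans ba.
by rewrite ler_pdivrMr // mul1r ltW.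
Qed.

Definition ihom a b : {i01 R} := Itv01 (ihom_num_ge0 a b) (ihom_num_le1 a b).

Lemma le_ihom a b c : (c%:num <= (ihom a b)%:num) = (c%:num * a%:num <= b%:num).
Proof.
rewrite /= /ihom_num; case: ifP => [ba|/negbT]; last rewrite -leNgt => ab.
  by rewrite ler_pdivlMr //; exact: le_lt_trans ba.
by rewrite le1 (le_trans _ ab)// ler_piMl.
Qed.

(* The infimum of a family taken in [0,1]: the inf of the library over R is 0
   on the empty set, whereas an empty family has infimum 1 here. *)
Definition infI_num (I : Type) (F : I -> {i01 R}) : R :=
  inf (1 |` range (fun i => (F i)%:num)).

Lemma infI_num_ge0 (I : Type) (F : I -> {i01 R}) : 0 <= infI_num F.
Proof. by apply: lb_le_inf => [|_ [->|[i _ <-]]] //; exists 1; left. Qed.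

Lemma infI_num_le1 (I : Type) (F : I -> {i01 R}) : infI_num F <= 1.
Proof. by apply: ge_inf; [exists 0 => _ [->|[i _ <-]]|left]. Qed.

Definition infI (I : Type) (F : I -> {i01 R}) : {i01 R} :=
  Itv01 (infI_num_ge0 F) (infI_num_le1 F).

Lemma infI_lb (I : Type) (F : I -> {i01 R}) i : (infI F)%:num <= (F i)%:num.
Proof. by apply: ge_inf; [exists 0 => _ [->|[j _ <-]]|right; exists i]. Qed.

Lemma le_infI (I : Type) (F : I -> {i01 R}) a :
  (forall i, a%:num <= (F i)%:num) -> a%:num <= (infI F)%:num.
Proof.
by move=> aF; apply: lb_le_inf => [|_ [->|[i _ <-]]] //; exists 1; left.
Qed.

End UnitInterval.

Record icat (R : realType) := ICat {
  obj :> Type;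
  hom : obj -> obj -> {i01 R};
  hom_id : forall x, (hom x x)%:num = 1;
  hom_comp : forall x y z,
    (hom y z)%:num * (hom x y)%:num <= (hom x z)%:num }.

Record ifunctor (R : realType) (C D : icat R) := IFunctor {
  fobj :> C -> D;
  fhom : forall x y, (hom x y)%:num <= (hom (fobj x) (fobj y))%:num }.

Section Constructions.
Variable R : realType.
Implicit Types C D J : icat R.

Definition opcat C : icat R.
Proof.
refine (@ICat R C (fun x y => hom y x) (@hom_id R C) _).
by move=> x y z; rewrite mulrC; exact: hom_comp.
Defined.

(* [0,1] enriched over itself *)
Definition unitcat : icat R.
Proof.
refine (@ICat R {i01 R} (@ihom R) _ _) => [x|x y z].
  by rewrite /= /ihom_num ltxx.
rewrite (le_ihom x z ((ihom y z)%:num * (ihom x y)%:num)%:i01) /= -mulrA.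
have h1 : (ihom x y)%:num * x%:num <= y%:num by rewrite -le_ihom.
have h2 : (ihom y z)%:num * y%:num <= z%:num by rewrite -le_ihom.
apply: le_trans h2; apply: ler_wpM2l; first exact: ihom_num_ge0.
exact: h1.
Defined.

Definition copresheaf C := ifunctor C unitcat.

Definition chom C (f g : copresheaf C) : {i01 R} :=
  infI (fun c => ihom (f c) (g c)).

Definition copresheaves C : icat R.
Proof.
refine (@ICat R (copresheaf C) (@chom C) _ _) => [f|f g h].
  apply/eqP; rewrite eq_le le1 /=; apply: (@le_infI _ _ _ 1%:i01) => c /=.
  by rewrite /ihom_num ltxx.
apply: (@le_infI _ _ _ ((chom g h)%:num * (chom f g)%:num)%:i01) => c /=.
apply: le_trans (hom_comp (f c : unitcat) (g c) (h c)).
apply: ler_pM; [exact: infI_num_ge0|exact: infI_num_ge0| |].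
  exact: (infI_lb (fun c => ihom (g c) (h c))).
exact: (infI_lb (fun c => ihom (f c) (g c))).
Defined.

(* For F : J -> D and Z an object of D, the weight D(F -, Z) on J^op. *)
Definition hom_to J D (F : ifunctor J D) (Z : D) : copresheaf (opcat J).
Proof.
refine (@IFunctor R (opcat J) unitcat (fun i => hom (F i) Z) _) => i j.
rewrite le_ihom mulrC; apply: le_trans (hom_comp (F j) (F i) Z).
by rewrite ler_wpM2l //; exact: (fhom F).
Defined.

Definition is_weighted_colimit J D (W : copresheaf (opcat J))
    (F : ifunctor J D) (X : D) : Prop :=
  forall Z : D, hom X Z = hom (W : copresheaves (opcat J)) (hom_to F Z).

Definition discrete (T : eqType) : icat R.
Proof.
refine (@ICat R T (fun x y => if x == y then 1%:i01 else 0%:i01) _ _).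
  by move=> x; rewrite eqxx.
move=> x y z; case: (eqVneq x y) => [<-|_]; first by rewrite mulr1.
by rewrite mulr0.
Defined.

Definition discrete_diagram (T : eqType) D (F : T -> D) :
  ifunctor (discrete T) D.
Proof.
refine (@IFunctor R (discrete T) D F _) => x y /=.
case: (eqVneq x y) => [<-|_]; first by rewrite (hom_id (F x)).
exact: ge0.
Defined.

Definition discrete_weight (T : eqType) (w : T -> {i01 R}) :
  copresheaf (opcat (discrete T)).
Proof.
refine (@IFunctor R (opcat (discrete T)) unitcat w _) => x y /=.
by case: (eqVneq y x) => [<-|_]; rewrite ?ihom_num_ge0 // /ihom_num ltxx.
Defined.

End Constructions.

(* ext_prob L y x is pi(y|x), the probability that y extends x; the subtext
   relation is left abstract (e.g. infix on strings). *)
Record language (R : realType) := Language {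
  text : Type;
  subtext : text -> text -> Prop;
  ext_prob : text -> text -> {i01 R};
  ext_prob_nsub : forall x y, ~ subtext x y -> (ext_prob y x)%:num = 0;
  ext_prob_id : forall x, (ext_prob x x)%:num = 1;
  ext_prob_comp : forall x y z,
    (ext_prob z y)%:num * (ext_prob y x)%:num <= (ext_prob z x)%:num }.

Definition syntax_category (R : realType) (L : language R) : icat R :=
  @ICat R (text L) (fun x y => ext_prob y x)
    (@ext_prob_id R L) (@ext_prob_comp R L).

(* The two-object discrete category is carried by bool: true is the object 1
   and false is the object 2. *)
Definition pair_index (R : realType) : icat R := discrete R bool.

Definition pair_weight (R : realType) (w1 w2 : {i01 R}) :
    copresheaf (opcat (pair_index R)) :=
  discrete_weight (fun i : bool => if i then w1 else w2).

Definition pair_diagram (R : realType) (D : icat R) (f g : D) :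
    ifunctor (pair_index R) D :=
  discrete_diagram (fun i : bool => if i then f else g).

(* Main.v *)
Require Import Defs.
From mathcomp Require Import all_boot all_order all_algebra.
From mathcomp Require Import boolp classical_sets reals interval_inference.

(** An element a of [0,1] lies below hom(max(w1 f, w2 g), Z) iff
    a w1 f <= Z and a w2 g <= Z pointwise, iff a w1 <= hom(f, Z) and
    a w2 <= hom(g, Z), iff a lies below the hom object of weights.  Hence the
    pointwise maximum is a weighted colimit, and antisymmetry of the pointwise
    order on copresheaves makes it the only one. *)

Local Open Scope ring_scope.

Import Order.TTheory GRing.Theory Num.Theory.

(** Taking [a] to be [x] and then [y] gives both inequalities. Hom objects of copresheaves are
    infima, hence easiest to compare through their lower bounds. *)
Lemma i01_eq_lower {R : realType} (x y : {i01 R}) :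
  (forall a : {i01 R}, a%:num <= x%:num <-> a%:num <= y%:num) -> x = y.
Proof.
move=> xy; apply/val_inj/le_anti/andP.
by split; [apply/(xy x) | apply/(xy y)].
Qed.

Lemma le_infIP {R : realType} {I : Type} (F : I -> {i01 R}) (a : {i01 R}) :
  a%:num <= (infI F)%:num <-> forall i, a%:num <= (F i)%:num.
Proof.
by split=> [aF i|]; [exact: le_trans aF (infI_lb F i) | exact: le_infI].
Qed.

(** Multiplication is adjoint to [ihom] at each object. This serves both for copresheaves on [C] and
    for weights on the index category. *)
Lemma le_chomP {R : realType} {C : icat R} (f g : copresheaf C) (a : {i01 R}) :
  a%:num <= (chom f g)%:num <->
  forall c, a%:num * (f c : {i01 R})%:num <= (g c : {i01 R})%:num.
Proof.
split=> [/le_infIP fg c|fg]; first by rewrite -le_ihom; exact: fg.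
by apply/le_infIP => c; rewrite le_ihom; exact: fg.
Qed.

Lemma chom_eq1P {R : realType} {C : icat R} (f g : copresheaf C) :
  (chom f g)%:num = 1 <->
  forall c, (f c : {i01 R})%:num <= (g c : {i01 R})%:num.
Proof.
split=> [fg1 c|fg].
  by rewrite -[leLHS]mul1r; apply: ((le_chomP f g 1%:i01).1 _ c); rewrite fg1.
apply/le_anti; rewrite le1 /=.
by apply: ((le_chomP f g 1%:i01).2) => c; rewrite mul1r; exact: fg.
Qed.

Section WeightedMax.
Context {R : realType} {C : icat R} (w1 w2 : {i01 R}) (f g : copresheaf C).

Definition weighted_max_obj (c : C) : {i01 R} :=
  (Num.max (w1%:num * (f c : {i01 R})%:num)
           (w2%:num * (g c : {i01 R})%:num))%:i01.

(** Multiplication by a nonnegative number distributes over the maximum, and each branch at [x] is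
    bounded by the same branch at [y]. *)
Lemma weighted_max_hom (x y : C) :
  (Defs.hom x y)%:num <=
  (ihom (weighted_max_obj x) (weighted_max_obj y))%:num.
Proof.
rewrite le_ihom /= maxr_pMr // ge_max !le_max !(mulrCA (Defs.hom x y)%:num).
apply/andP; split; apply/orP; [left | right];
  rewrite ler_wpM2l // -le_ihom; [exact: (fhom f) | exact: (fhom g)].
Qed.

Definition weighted_max : copresheaf C :=
  @IFunctor R C (unitcat R) weighted_max_obj weighted_max_hom.

Lemma weighted_max_colimit :
  @is_weighted_colimit R (pair_index R) (copresheaves C)
    (pair_weight w1 w2) (@pair_diagram R (copresheaves C) f g) weighted_max.
Proof.
move=> Z; apply: i01_eq_lower => a; split=> [/le_chomP aZ | aZ].
  have aZ' c : (a%:num * w1%:num * (f c : {i01 R})%:num <= (Z c : {i01 R})%:num)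
            && (a%:num * w2%:num * (g c : {i01 R})%:num <= (Z c : {i01 R})%:num).
    by rewrite -!mulrA -ge_max -maxr_pMr //; exact: aZ.
  (* The adjunction over the two indices moves each weight next to [a]; the adjunction over [C] then
     applies with scalar [a * w1] or [a * w2]. *)
  apply/le_chomP => -[] /=.
    by apply: ((le_chomP f Z (a%:num * w1%:num)%:i01).2) => c; case/andP: (aZ' c).
  by apply: ((le_chomP g Z (a%:num * w2%:num)%:i01).2) => c; case/andP: (aZ' c).
move/le_chomP: aZ => aW; apply/le_chomP => c /=.
rewrite maxr_pMr // ge_max !mulrA; apply/andP; split.
  exact: ((le_chomP f Z (a%:num * w1%:num)%:i01).1 (aW true) c).
exact: ((le_chomP g Z (a%:num * w2%:num)%:i01).1 (aW false) c).
Qed.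

End WeightedMax.

(** Testing both universal properties at [Y] gives hom(X, Y) = hom(Y, Y) = 1, so X lies below Y
    pointwise; testing at [X] gives the converse. *)
Lemma weighted_colimit_unique {R : realType} {C J : icat R}
    (W : copresheaf (opcat J)) (F : ifunctor J (copresheaves C))
    (X Y : copresheaf C) :
  @is_weighted_colimit R J (copresheaves C) W F X ->
  @is_weighted_colimit R J (copresheaves C) W F Y ->
  forall c, X c = Y c.
Proof.
move=> colX colY c; apply/val_inj/le_anti/andP; split.
  apply: (chom_eq1P X Y).1; rewrite -(hom_id (Y : copresheaves C)).
  by congr (_%:num); rewrite -[LHS]/(Defs.hom (X : copresheaves C) Y) colX colY.
apply: (chom_eq1P Y X).1; rewrite -(hom_id (X : copresheaves C)).
by congr (_%:num); rewrite -[LHS]/(Defs.hom (Y : copresheaves C) X) colX colY.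
Qed.

Theorem theorem3 (R : realType) (L : language R)
    (f g : copresheaf (syntax_category L)) (w1 w2 : {i01 R}) :
  let Lhat := copresheaves (syntax_category L) in
  let W := pair_weight w1 w2 in
  let F := @pair_diagram R Lhat f g in
  (exists X : copresheaf (syntax_category L),
      @is_weighted_colimit R (pair_index R) Lhat W F X) /\
  (forall X : copresheaf (syntax_category L),
      @is_weighted_colimit R (pair_index R) Lhat W F X ->
      forall c : text L,
        (X c : {i01 R})%:num =
        Num.max (w1%:num * (f c : {i01 R})%:num)
                (w2%:num * (g c : {i01 R})%:num)).
Proof.
move=> Lhat W F; have colM := weighted_max_colimit w1 w2 f g.
split; first by exists (weighted_max w1 w2 f g).
by move=> X colX c; rewrite (weighted_colimit_unique _ _ _ _ colX colM c).
Qed.
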